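(* Let $R>0$ and $\alpha\in[0,1)$, and let $\pi_{\rm loc}$ be a probability density on $(0,\infty)$ with $\|\pi_{\rm loc}\|_\infty:=\sup_\lambda\pi_{\rm loc}(\lambda)<\infty$, absolutely continuous at $\lambda_{\min}$ in the sense of the context. For $\tau>0$ and $\beta_j^*\ne0$, let $\lambda_j\mid\beta_j^*,\tau$ have density proportional to $\lambda_j^{-1}\exp\!\big(-\beta_j^{*2}/(2\tau^2\lambda_j^2)\big)\pi_{\rm loc}(\lambda_j)$ on $(0,\infty)$. Then there is an increasing function $\gamma(r)>0$ with $\lim_{r\to0}\gamma(r)=0$, for which the expectation with respect to $\lambda_j\mid\beta_j^*,\tau$ satisfies $$\mathbb E\big[\tau^{-\alpha}\lambda_j^{-\alpha}\mid\tau,\beta_j^*\big]\ \le\ \gamma(R/\tau)\left(|\beta_j^*|^{-\alpha}+|R|^{-\alpha}\right).$$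
   Context: Standing assumption: with $\lambda_{\min}=\inf\{\lambda:\pi_{\rm loc}(\lambda)>0\}$, $\pi_{\rm loc}$ is absolutely continuous at $\lambda_{\min}$, i.e. absolutely continuous on some right-neighborhood $[\lambda_{\min},\lambda_{\min}+\epsilon)$. The conditional law of $\lambda_j$ is the one induced by the global-local prior $\beta_j\mid\tau,\lambda_j\sim\mathcal N(0,\tau^2\lambda_j^2)$, $\lambda_j\sim\pi_{\rm loc}$, where $\tau$ is the global scale and $\lambda_j$ the local scale; $\beta_j^*$ denotes the value of $\beta_j$ being conditioned on.
   Formalization: The limit γ(r)→0 as r→0 is asserted only for α>0; at α=0 it is false, since the left side is 1 while the right side 2γ(R/τ) would tend to 0 as τ→∞. The bound, positivity and monotonicity of γ are kept for all α in [0,1). *)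

(* Defs.v *)
From HB Require Import structures.
From mathcomp Require Import all_boot all_order all_algebra.
From mathcomp Require Import all_classical all_reals all_analysis.
From mathcomp Require Import measurable_realfun.

Set Implicit Arguments.
Unset Strict Implicit.
Unset Printing Implicit Defensive.

Import Order.TTheory GRing.Theory Num.Theory.
Import numFieldNormedType.Exports.

Local Open Scope classical_set_scope.
Local Open Scope ring_scope.

(* A density on (0, +oo) is encoded as a total function R -> R; its values on
   ]-oo, 0] are irrelevant and are never inspected below. *)
Definition pos_density (R : realType) (f : R -> R) : Prop :=
  [/\ measurable_fun (`]0, +oo[ : set R) f,
      (forall x, 0 < x -> 0 <= f x) &
      (\int[lebesgue_measure]_(x in `]0%R, +oo[) (f x)%:E = 1)%E].

Definition pos_sup (R : realType) (f : R -> R) : \bar R :=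
  ereal_sup [set (f x)%:E | x in `]0, +oo[].

(* The usual epsilon-delta definition, for an interval A. *)
Definition abs_continuous_on (R : realType) (A : set R) (f : R -> R) : Prop :=
  forall e : R, 0 < e -> exists2 d : R, 0 < d &
    forall (n : nat) (a b : 'I_n -> R),
      (forall i, a i <= b i /\ `[a i, b i] `<=` A) ->
      trivIset setT (fun i => `]a i, b i[%classic) ->
      \sum_(i < n) (b i - a i) < d ->
      \sum_(i < n) `|f (b i) - f (a i)| < e.

Definition lambda_min (R : realType) (f : R -> R) : R :=
  inf [set l | 0 < l /\ 0 < f l].

(* The intersection with ]0, +oo[ only matters when lambda_min f = 0, where f
   has no prescribed value: absolute continuity on ]0, e[ is then the same as
   absolute continuity on [0, e[ of the continuous extension of f to 0. *)
Definition abs_continuous_at_min (R : realType) (f : R -> R) : Prop :=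
  exists2 e : R, 0 < e &
    abs_continuous_on
      (`[lambda_min f, lambda_min f + e[ `&` `]0, +oo[) f.

Definition local_scale_kernel (R : realType) (piloc : R -> R) (tau beta : R)
    (l : R) : R :=
  l^-1 * expR (- (beta ^+ 2 / (2 * tau ^+ 2 * l ^+ 2))) * piloc l.

(* P is the law on (0, +oo) whose density is proportional to k; since P has
   total mass 1, the constant c is determined by k. *)
Definition pos_density_proportional_to (R : realType)
    (P : probability (measurableTypeR R) R) (k : R -> R) : Prop :=
  exists2 c : R, 0 < c & forall A : set R, measurable A ->
    P A = (\int[lebesgue_measure]_(l in A `&` `]0%R, +oo[) (c * k l)%:E)%E.

(* Main.v *)
(* Write b = |beta| / tau and let F b be the posterior mean of l `^ (- a) at
   tau = 1, so that the expectation to be bounded is tau `^ (- a) * F b and it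
   suffices that F b <= gamma r * (b `^ (- a) + r `^ (- a)) for all b, r > 0.
   A suitable gamma exists as soon as F b <= e * b `^ (- a) + C_e for every
   e > 0. When lambda_min > 0, F is bounded. When lambda_min = 0, splitting the
   integral at l = K * b shows F b = o(b `^ (- a)) as b -> 0, because near 0 the
   density is negligible compared with the normalizing constant D b: either it
   vanishes at 0+ while D b stays away from 0, or it has a positive lower bound
   near 0 and D b diverges logarithmically. Away from b = 0, F is bounded since
   it is nonincreasing, by a correlation inequality. *)

Require Import Defs.
From HB Require Import structures.
From mathcomp Require Import all_boot all_order all_algebra.
From mathcomp Require Import all_classical all_reals all_analysis.
From mathcomp Require Import measurable_realfun.
From mathcomp Require Import ring lra.

Set Implicit Arguments.
Unset Strict Implicit.
Unset Printing Implicit Defensive.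

Import Order.TTheory GRing.Theory Num.Theory.
Import numFieldNormedType.Exports.

Local Open Scope classical_set_scope.
Local Open Scope ring_scope.

(** * General tools: integration against a density, and the construction of [gamma] *)

(** [h] and the Radon-Nikodym derivative of [P] have the same integral over every measurable set, so
    they agree almost everywhere, and the change of variables known for the derivative carries over
    to [h]. *)
Lemma ge0_integral_density d (T : measurableType d) (R : realType)
    (P : {finite_measure set T -> \bar R})
    (mu : {sigma_finite_measure set T -> \bar R}) (h g : T -> \bar R) :
  measurable_fun setT h -> (forall x, 0 <= h x)%E ->
  (forall A, measurable A -> P A = \int[mu]_(x in A) h x)%E ->
  measurable_fun setT g -> (forall x, 0 <= g x)%E ->
  (\int[P]_x g x = \int[mu]_x (g x * h x))%E.
Proof.
move=> mh h0 Ph mg g0.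
have Pmu : P `<< mu.
  apply/null_content_dominatesP => A mA muA0.
  by rewrite Ph// (null_set_integral mA) //; exact: measurable_funTS.
have fi := Radon_Nikodym_SigmaFinite.f_integrable Pmu.
rewrite -(Radon_Nikodym_SigmaFinite.change_of_variables Pmu)//.
apply: ae_eq_integral => //.
- by apply: emeasurable_funM => //; exact: measurable_int fi.
- exact: emeasurable_funM.
apply: ae_eqe_mul2l.
apply: integral_ae_eq => // E _ mE.
by rewrite -Ph// -(Radon_Nikodym_SigmaFinite.f_integral Pmu).
Qed.

(* The supremum over [b] of [F b / (b `^ (- a) + r `^ (- a))] is nondecreasing in
   [r]; adding [r] makes it positive and strictly increasing. *)
Lemma exists_increasing_gauge (R : realType) (a : R) (F : R -> R) :
  0 <= a -> (forall b, 0 < b -> 0 <= F b) ->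
  (forall e, 0 < e -> exists C, forall b, 0 < b -> F b <= e * b `^ (- a) + C) ->
  exists gamma : R -> R,
    [/\ (forall r, 0 < r -> 0 < gamma r),
        (forall r s, 0 < r -> r < s -> gamma r < gamma s),
        (0 < a -> gamma r @[r --> 0^'+] --> 0) &
        forall b r, 0 < b -> 0 < r ->
          F b <= gamma r * (b `^ (- a) + r `^ (- a))].
Proof.
move=> a0 F0 FC.
pose E r := [set F b / (b `^ (- a) + r `^ (- a)) | b in [set b | 0 < b]].
have den0 b r : 0 < b -> 0 < r -> 0 < b `^ (- a) + r `^ (- a).
  by move=> b0 r0; rewrite addr_gt0// powR_gt0.
have FC' e : 0 < e -> exists2 C, 0 <= C & forall r, 0 < r ->
    ubound (E r) (e + C * r `^ a).
  move=> e0; have [C hC] := FC _ e0; exists `|C| => // r r0 _ [b /= b0 <-].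
  rewrite ler_pdivrMr ?den0//; apply: (le_trans (hC _ b0)).
  have rr : r `^ a * r `^ (- a) = 1.
    by rewrite powRN divff// gt_eqF// powR_gt0.
  rewrite mulrDl !mulrDr -!mulrA rr mulr1 -addrA lerD2l.
  rewrite (le_trans (ler_norm C))// addrA lerDr addr_ge0// mulr_ge0 ?powR_ge0//.
    exact: ltW.
  by rewrite mulr_ge0 ?powR_ge0.
have supE r : 0 < r -> has_sup (E r).
  move=> r0; split.
    by exists (F 1 / (1 `^ (- a) + r `^ (- a))); exists 1 => /=; rewrite ?ltr01.
  by have [C C0 hC] := FC' _ ltr01; exists (1 + C * r `^ a); exact: hC.
have sup0 r : 0 < r -> 0 <= sup (E r).
  move=> r0; apply: (@le_trans _ _ (F 1 / (1 `^ (- a) + r `^ (- a)))).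
    by rewrite divr_ge0 ?F0// ltW// den0.
  by apply: ub_le_sup; [exact: (supE r r0).2|exists 1 => /=; rewrite ?ltr01].
exists (fun r => sup (E r) + r); split.
- by move=> r r0; rewrite ltr_wpDl// sup0.
- move=> r s r0 rs; have s0 := lt_trans r0 rs.
  rewrite ler_ltD//; apply: ge_sup; first exact: (supE r r0).1.
  move=> _ [b /= b0 <-].
  apply: (@le_trans _ _ (F b / (b `^ (- a) + s `^ (- a)))).
    rewrite ler_wpM2l ?F0// lef_pV2 ?posrE ?den0// lerD2l !powRN.
    rewrite lef_pV2 ?posrE ?powR_gt0//.
    by rewrite ge0_ler_powR// ?nnegrE ltW.
  by apply: ub_le_sup; [exact: (supE s s0).2|exists b].
- move=> a_gt0; apply/cvgr0Pnorm_lt => e e0.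
  have e3 : 0 < e / 3 by lra.
  have [C C0 hC] := FC' _ e3.
  have : C * r `^ a @[r --> 0^'+] --> C * 0.
    by apply: cvgM; [exact: cvg_cst|exact: powR_cvg0].
  rewrite mulr0 => /cvgr0Pnorm_lt /(_ _ e3) hlim.
  near=> r.
  have r0 : 0 < r by near: r; exact: nbhs_right_gt.
  have h1 : `|C * r `^ a| < e / 3 by near: r; exact: hlim.
  have h2 : r < e / 3 by near: r; exact: nbhs_right_lt.
  rewrite ger0_norm ?addr_ge0 ?sup0 ?(ltW r0)//.
  have : sup (E r) <= e / 3 + C * r `^ a.
    by apply: ge_sup; [exact: (supE r r0).1|exact: hC].
  rewrite ger0_norm in h1; last by rewrite mulr_ge0 ?powR_ge0.
  by move=> h3; lra.
- move=> b r b0 r0; rewrite -ler_pdivrMr ?den0//.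
  apply: (@le_trans _ _ (sup (E r))); last by rewrite lerDl ltW.
  by apply: ub_le_sup; [exact: (supE r r0).2|exists b].
Unshelve. all: by end_near. Qed.

(** * The posterior kernel at unit global scale and its moments *)

Definition scale_kernel (R : realType) (f : R -> R) (a b l : R) : R :=
  l `^ (- a) * (l^-1 * expR (- (b ^+ 2 / (2 * l ^+ 2)))) * f l.

(** At [a = 0] this is the normalizing constant [D b], so [F b] is
    [scale_moment f a b / scale_moment f 0 b]. *)
Definition scale_moment (R : realType) (f : R -> R) (a b : R) : R :=
  (\int[lebesgue_measure]_(l in `]0%R, +oo[) scale_kernel f a b l)%R.

(** This is [exp (- x) <= 1 / x], a consequence of [1 + x <= exp x]. The factor [l ^+ 2] it provides
    compensates the singularity of the kernel at 0. *)
Lemma expR_Ninv_sqr_le (R : realType) (b l : R) : 0 < b -> 0 < l ->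
  expR (- (b ^+ 2 / (2 * l ^+ 2))) <= 2 * l ^+ 2 / b ^+ 2.
Proof.
move=> b0 l0.
have x0 : 0 < b ^+ 2 / (2 * l ^+ 2) by rewrite divr_gt0 ?mulr_gt0 ?exprn_gt0.
rewrite -[leRHS]invrK invf_div expRN lef_pV2 ?posrE ?expR_gt0//.
by rewrite (le_trans _ (expR_ge1Dx _))// lerDr.
Qed.

Lemma expR_Nsqr_le1 (R : realType) (b l : R) :
  expR (- (b ^+ 2 / (2 * l ^+ 2))) <= 1.
Proof.
by rewrite -[leRHS]expR0 ler_expR oppr_le0 divr_ge0 ?sqr_ge0// mulr_ge0 ?sqr_ge0.
Qed.

Lemma measurable_inv_pos (R : realType) :
  measurable_fun (`]0, +oo[ : set R) (fun x : R => x^-1).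
Proof.
apply: (eq_measurable_fun (fun x : R => x `^ (-1))).
  by move=> x; rewrite inE/= in_itv/= andbT => x0; rewrite powR_inv1// ltW.
by apply: measurable_funTS; exact: measurable_powR.
Qed.

Section moments.
Context (R : realType) (f : R -> R).
Hypothesis f_dens : pos_density f.
Let mu := @lebesgue_measure R.
Let pos : set R := `]0, +oo[.

Let posE l : pos l = (0 < l) :> Prop.
Proof. by rewrite /pos/= in_itv/= andbT. Qed.

Let mpos : measurable (pos : set (measurableTypeR R)).
Proof. exact: measurable_itv. Qed.

Let f_ge0 l : 0 < l -> 0 <= f l.
Proof. by case: f_dens => _ + _; exact. Qed.

Lemma measurable_scale_kernel a b : measurable_fun pos (scale_kernel f a b).
Proof.
apply: measurable_funM; last by case: f_dens.
apply: measurable_funM.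
  by apply: measurable_funTS; exact: measurable_powR.
apply: measurable_funM; first exact: measurable_inv_pos.
apply: measurableT_comp => //; apply: measurableT_comp => //.
apply: (eq_measurable_fun (fun x : R => b ^+ 2 / 2 * x^-1 ^+ 2)).
  by move=> x _; rewrite invfM exprVn mulrA.
by apply: measurable_funM => //; apply: measurable_funX; exact: measurable_inv_pos.
Qed.

Lemma scale_kernel_ge0 a b l : 0 < l -> 0 <= scale_kernel f a b l.
Proof.
move=> l0; rewrite mulr_ge0 ?f_ge0// mulr_ge0 ?powR_ge0// mulr_ge0 ?expR_ge0//.
by rewrite invr_ge0 ltW.
Qed.

Let integrable_density : mu.-integrable pos (EFin \o f).
Proof.
case: f_dens => mf f0 f1; apply/integrableP; split; first exact/measurable_EFinP.
rewrite (_ : \int[mu]_(x in _) _ = 1)%E ?ltry// -f1.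
apply: eq_integral => x; rewrite inE => xpos /=.
by rewrite ger0_norm// f0// -posE.
Qed.

(** For [1 <= l] every factor in front of [f l] is at most 1. For [l < 1] the powers of [l]
    contribute at most [l ^- 2], because [a <= 1], and the bound on the exponential cancels them.
    Integrability of the kernel follows by domination. *)
Lemma scale_kernel_le a b l : 0 <= a <= 1 -> 0 < b -> 0 < l ->
  scale_kernel f a b l <= (1 + 2 / b ^+ 2) * f l.
Proof.
move=> /andP[a0 a1] b0 l0; rewrite ler_wpM2r ?f_ge0//.
have e0 := expR_gt0 (- (b ^+ 2 / (2 * l ^+ 2))).
have b20 : 0 <= 2 / b ^+ 2 by rewrite divr_ge0 ?sqr_ge0.
have [l1|l1] := leP 1 l.
  apply: (@le_trans _ _ 1); last by rewrite lerDl.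
  rewrite mulr_ile1 ?powR_ge0 ?mulr_ge0 ?invr_ge0 ?(ltW l0) ?(ltW e0)//.
    rewrite powRN invf_le1 ?powR_gt0//; have : 1 `^ a <= l `^ a.
      by rewrite ge0_ler_powR ?nnegrE ?(ltW l0).
    by rewrite powR1.
  by rewrite mulr_ile1 ?invr_ge0 ?(ltW l0) ?(ltW e0) ?invf_le1 ?expR_Nsqr_le1.
apply: (@le_trans _ _ (2 / b ^+ 2)); last by rewrite lerDr.
apply: (@le_trans _ _ (l^-1 * (l^-1 * (2 * l ^+ 2 / b ^+ 2)))).
  apply: ler_pM; rewrite ?powR_ge0 ?mulr_ge0 ?invr_ge0 ?(ltW l0) ?(ltW e0)//.
    rewrite powRN lef_pV2 ?posrE ?powR_gt0//.
    by rewrite ger1_powR ?l0 ?(ltW l1).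
  by rewrite ler_pM2l ?invr_gt0// expR_Ninv_sqr_le.
by rewrite le_eqVlt; apply/orP; left; apply/eqP; field; rewrite !gt_eqF.
Qed.

Lemma integrable_scale_kernel a b : 0 <= a <= 1 -> 0 < b ->
  mu.-integrable pos (EFin \o scale_kernel f a b).
Proof.
move=> a01 b0.
have gi := integrableZl mpos (1 + 2 / b ^+ 2) integrable_density.
apply: (le_integrable mpos _ _ gi).
  by apply/measurable_EFinP; exact: measurable_scale_kernel.
move=> l; rewrite posE => l0 /=; rewrite lee_fin ger0_norm ?scale_kernel_ge0//.
by rewrite (le_trans (scale_kernel_le _ _ _))// ler_norm.
Qed.

(** A zero moment would force the kernel, hence [f], to vanish almost everywhere, against total mass
    1. *)
Lemma scale_moment_gt0 a b : 0 <= a <= 1 -> 0 < b -> 0 < scale_moment f a b.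
Proof.
move=> a01 b0; rewrite lt_neqAle Rintegral_ge0 ?andbT; last first.
  by move=> l; rewrite /= in_itv/= andbT; exact: scale_kernel_ge0.
apply/negP => /eqP /esym m0.
have ki := integrable_scale_kernel a01 b0.
have mk : measurable_fun pos (EFin \o scale_kernel f a b).
  exact: measurable_int ki.
have k0 : ae_eq mu pos (EFin \o scale_kernel f a b) (cst 0%E).
  apply/ae_eq_integral_abs => //.
  transitivity (\int[mu]_(l in pos) (EFin \o scale_kernel f a b) l)%E.
    apply: eq_integral => l; rewrite inE posE => l0 /=.
    by rewrite ger0_norm// scale_kernel_ge0.
  by rewrite -[LHS]fineK ?integrable_fin_num//; congr EFin.
have f0 : ae_eq mu pos (EFin \o f) (cst 0%E).
  apply: filterS k0 => l /= + lpos => /(_ lpos); rewrite posE in lpos.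
  move=> [] /eqP; rewrite mulf_eq0 => /orP[|/eqP -> //].
  by rewrite !mulf_eq0 !gt_eqF ?powR_gt0 ?invr_gt0 ?expR_gt0.
case: f_dens => mf _ f1; have : (\int[mu]_(l in pos) (f l)%:E = 0)%E.
  rewrite (ae_eq_integral (cst 0%E))//; first by rewrite integral0.
  exact/measurable_EFinP.
by rewrite f1 => -[] /eqP; rewrite oner_eq0.
Qed.


(** * Comparison of moments at different values of [b] *)

Let zero_in01 : 0 <= (0 : R) <= 1.
Proof. by rewrite lexx ler01. Qed.

Let integrableD_EFin (h1 h2 : R -> R) : mu.-integrable pos (EFin \o h1) ->
  mu.-integrable pos (EFin \o h2) ->
  mu.-integrable pos (EFin \o (fun l => h1 l + h2 l)).
Proof.
move=> ih1 ih2; under [X in _.-integrable _ X]eq_fun do rewrite /= EFinD.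
exact: (integrableD mpos ih1 ih2).
Qed.

Let integrableZ_EFin c (h : R -> R) : mu.-integrable pos (EFin \o h) ->
  mu.-integrable pos (EFin \o (fun l => c * h l)).
Proof.
move=> ih; under [X in _.-integrable _ X]eq_fun do rewrite /= EFinM.
exact: (integrableZl mpos _ ih).
Qed.

Let Rintegral_lin c1 c2 (h1 h2 : R -> R) : mu.-integrable pos (EFin \o h1) ->
  mu.-integrable pos (EFin \o h2) ->
  \int[mu]_(l in pos) (c1 * h1 l + c2 * h2 l) =
  c1 * \int[mu]_(l in pos) h1 l + c2 * \int[mu]_(l in pos) h2 l.
Proof.
move=> ih1 ih2; rewrite (RintegralD mpos) ?(RintegralZl _ mpos)//.
- exact: integrableZ_EFin.
- exact: integrableZ_EFin.
Qed.

(* [l `^ (- a)] is nonincreasing and the likelihood ratio of the two kernels is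
   nondecreasing in [l]. Chebyshev's correlation inequality is obtained by
   integrating [(l `^ (- a) - g) * (ratio l - ratio m) <= 0], where [m] is the
   point at which [m `^ (- a)] equals the mean [g]. *)
Lemma scale_moment_ratio_le a b0 b : 0 <= a <= 1 -> 0 < b0 -> b0 <= b ->
  scale_moment f a b * scale_moment f 0 b0 <=
  scale_moment f a b0 * scale_moment f 0 b.
Proof.
move=> a01 b00 b0b; have [->|a_neq0] := eqVneq a 0.
  by rewrite [leRHS]mulrC lexx.
have b_gt0 := lt_le_trans b00 b0b.
have a_gt0 : 0 < a by rewrite lt_neqAle eq_sym a_neq0; case/andP : a01.
have [N0 N0E] : exists N0, N0 = scale_moment f a b0.
  by exists (scale_moment f a b0).
have [D0 D0E] : exists D0, D0 = scale_moment f 0 b0.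
  by exists (scale_moment f 0 b0).
have N0_gt0 : 0 < N0 by rewrite N0E; exact: scale_moment_gt0.
have D0_gt0 : 0 < D0 by rewrite D0E; exact: scale_moment_gt0.
rewrite -N0E -D0E.
pose g := N0 / D0; have g_gt0 : 0 < g by exact: divr_gt0.
pose m := g `^ (- a^-1); have m_gt0 : 0 < m by rewrite powR_gt0.
have mg : m `^ (- a) = g by rewrite -powRrM mulrNN mulVf// powRr1// ltW.
pose t l := expR (- ((b ^+ 2 - b0 ^+ 2) / (2 * l ^+ 2))).
have bb0 : 0 <= b ^+ 2 - b0 ^+ 2.
  by rewrite subr_ge0 ler_pXn2r// nnegrE ltW.
have t_le x y : 0 < x -> x <= y -> t x <= t y.
  move=> x0 xy; have y0 := lt_le_trans x0 xy.
  rewrite ler_expR lerN2 ler_wpM2l// lef_pV2 ?posrE ?mulr_gt0 ?exprn_gt0//.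
  by rewrite ler_pM2l// ler_pXn2r// nnegrE ltW.
have p_le x y : 0 < x -> x <= y -> y `^ (- a) <= x `^ (- a).
  move=> x0 xy; have y0 := lt_le_trans x0 xy.
  rewrite !powRN lef_pV2 ?posrE ?powR_gt0// ge0_ler_powR ?nnegrE//.
  - by case/andP : a01.
  - exact: ltW.
  - exact: ltW.
have tE a' l : 0 < l -> scale_kernel f a' b l = t l * scale_kernel f a' b0 l.
  move=> l0; rewrite /scale_kernel.
  have -> : b ^+ 2 / (2 * l ^+ 2) =
      (b ^+ 2 - b0 ^+ 2) / (2 * l ^+ 2) + b0 ^+ 2 / (2 * l ^+ 2).
    by rewrite -mulrDl subrK.
  by rewrite opprD expRD /t; ring.
have uE b' l : scale_kernel f a b' l = l `^ (- a) * scale_kernel f 0 b' l.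
  by rewrite /scale_kernel oppr0 powRr0 mul1r mulrA.
have ik a' b' := @integrable_scale_kernel a' b'.
(* The correlation integrand is expanded and its negative terms are moved to the right, so that each
   side is a combination of two moments. *)
have hle : 1 * scale_moment f a b + g * t m * D0 <=
    g * scale_moment f 0 b + t m * N0.
  rewrite N0E D0E /scale_moment.
  rewrite -(Rintegral_lin _ _ (ik _ _ a01 b_gt0) (ik _ _ zero_in01 b00)).
  rewrite -(Rintegral_lin _ _ (ik _ _ zero_in01 b_gt0) (ik _ _ a01 b00)).
  apply: le_Rintegral => //.
  - by apply: integrableD_EFin; apply: integrableZ_EFin; exact: ik.
  - by apply: integrableD_EFin; apply: integrableZ_EFin; exact: ik.
  move=> l; rewrite posE => l0.
  rewrite mul1r tE// !uE tE//; have k0 : 0 <= scale_kernel f 0 b0 l.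
    exact: scale_kernel_ge0.
  set k := scale_kernel f 0 b0 l in k0 *.
  rewrite -subr_le0; set d := (X in X <= 0).
  have -> : d = (l `^ (- a) - g) * (t l - t m) * k by rewrite /d; ring.
  rewrite mulr_le0_ge0// -mg.
  have [lm|ml] := leP l m.
    by rewrite mulr_ge0_le0// ?subr_ge0 ?subr_le0 ?p_le ?t_le.
  have /ltW ml' := ml.
  by rewrite mulr_le0_ge0// ?subr_ge0 ?subr_le0 ?p_le ?t_le.
(* By the choice of [g] as the mean at [b0], the two terms carrying [t m] cancel. *)
have gD : g * D0 = N0 by rewrite divfK// gt_eqF.
move: hle; rewrite mul1r -mulrA mulrCA gD lerD2r => h.
rewrite (le_trans (ler_wpM2r (ltW D0_gt0) h))// mulrAC gD.
exact: lexx.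
Qed.

Lemma scale_moment0_le b0 b : 0 < b0 -> b0 <= b ->
  scale_moment f 0 b <= scale_moment f 0 b0.
Proof.
move=> b00 b0b; have b_gt0 := lt_le_trans b00 b0b.
apply: le_Rintegral => //; try exact: integrable_scale_kernel.
move=> l; rewrite /= in_itv/= andbT => l0.
rewrite ler_wpM2r ?f_ge0// ler_wpM2l ?powR_ge0//.
rewrite ler_wpM2l ?invr_ge0 ?(ltW l0)// ler_expR lerN2 ler_wpM2r//.
  by rewrite invr_ge0 mulr_ge0 ?sqr_ge0.
by rewrite ler_pXn2r// nnegrE ltW.
Qed.

(** * Upper and lower estimates of the moments *)

(** Beyond the cut [K * b] the weight [l]^ (- a)[is at most its value at the cut, which gives the
    first term. Below the cut the exponential bound leaves]l [^ (1 - a) * (2 / b ^+ 2) * s], largest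
    at the cut since [a <= 1]. This is the constant [c]; integrated over a length [K * b] it gives
    the second term, where [b] cancels. *)
Lemma scale_moment_le a b K s : 0 <= a <= 1 -> 0 < b -> 0 < K -> 0 <= s ->
  (forall l, 0 < l -> l <= K * b -> f l <= s) ->
  scale_moment f a b <=
    (K * b) `^ (- a) * (scale_moment f 0 b + 2 * K ^+ 2 * s).
Proof.
move=> a01 b0 K0 s0 fs; have Kb0 : 0 < K * b by rewrite mulr_gt0.
have [a_ge0 a_le1] := andP a01.
pose A : set R := `]0, K * b]%classic.
have mA : measurable (A : set (measurableTypeR R)) by exact: measurable_itv.
have muA : lebesgue_measure A = (K * b)%:E.
  by rewrite lebesgue_measure_itv/= lte_fin Kb0 -EFinB subr0.
pose q := (K * b) `^ (- a); have q0 : 0 < q by rewrite powR_gt0.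
pose c := 2 * s * q * (K * b) / b ^+ 2.
have iI : mu.-integrable pos (EFin \o (\1_A : R -> R)).
  apply: (integrableS measurableT) => //.
  exact: (integrable_indic_itv 0 (K * b) false false).
have iK : mu.-integrable pos (EFin \o scale_kernel f 0 b).
  exact: integrable_scale_kernel.
have : scale_moment f a b <=
    \int[mu]_(l in pos) (q * scale_kernel f 0 b l + c * \1_A l).
  apply: le_Rintegral => //; first exact: integrable_scale_kernel.
    by apply: integrableD_EFin; exact: integrableZ_EFin.
  move=> l; rewrite /= in_itv/= andbT => l0.
  have k0 : 0 <= scale_kernel f 0 b l by exact: scale_kernel_ge0.
  have uE : scale_kernel f a b l = l `^ (- a) * scale_kernel f 0 b l.
    by rewrite /scale_kernel oppr0 powRr0 mul1r mulrA.
  have [lKb|lKb] := leP l (K * b).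
    rewrite indicE mem_set ?mulr1; last by rewrite /A/= in_itv/= l0.
    apply: (@le_trans _ _ c); last by rewrite lerDr mulr_ge0// ltW.
    have -> : c = q * (K * b) * (2 / b ^+ 2) * s by rewrite /c; ring.
    rewrite /scale_kernel ler_pM//; last exact: fs.
    - by rewrite mulr_ge0 ?powR_ge0// mulr_ge0 ?expR_ge0// invr_ge0 ltW.
    - exact: f_ge0.
    apply: (@le_trans _ _ (l `^ (- a) * (l^-1 * (2 * l ^+ 2 / b ^+ 2)))).
      by rewrite ler_pM2l ?powR_gt0// ler_pM2l ?invr_gt0// expR_Ninv_sqr_le.
    have -> : l `^ (- a) * (l^-1 * (2 * l ^+ 2 / b ^+ 2)) =
        l `^ (- a) * l * (2 / b ^+ 2) by field; rewrite !gt_eqF.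
    rewrite ler_wpM2r ?divr_ge0 ?sqr_ge0// /q.
    have powE x : 0 < x -> x `^ (- a) * x = x `^ (1 - a).
      move=> x0; rewrite -[X in _ * X]powRr1 ?ltW// -powRD ?[- a + 1]addrC//.
      by rewrite (gt_eqF x0) implybT.
    by rewrite !powE// ge0_ler_powR ?nnegrE ?subr_ge0// ltW.
  rewrite uE; apply: (@le_trans _ _ (q * scale_kernel f 0 b l)).
    rewrite ler_wpM2r// /q !powRN lef_pV2 ?posrE ?powR_gt0//.
    by rewrite ge0_ler_powR ?nnegrE// ltW.
  by rewrite lerDl mulr_ge0// /c !mulr_ge0 ?invr_ge0 ?sqr_ge0// ltW.
move=> /le_trans; apply.
rewrite (Rintegral_lin _ _ iK iI).
have -> : \int[mu]_(l in pos) (\1_A : R -> R) l = K * b.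
  rewrite /Rintegral integral_indic//.
  have -> : A `&` pos = A.
    by apply/setIidPl => l; rewrite posE /A/= in_itv/= => /andP[].
  by rewrite (_ : _ A = (K * b)%:E)//; exact: muA.
rewrite -/(scale_moment f 0 b) mulrDr lerD2l le_eqVlt; apply/orP; left; apply/eqP.
by rewrite /c /q; field; rewrite gt_eqF.
Qed.

(** On [[b, r]] the exponent [b ^+ 2 / (2 * l ^+ 2)] is at most 1/2, so the kernel dominates a
    constant times [l^-1], whose integral is a difference of logarithms. *)
Lemma scale_moment0_ge_ln d r b : 0 < d -> 0 < b -> b < r ->
  (forall l, 0 < l -> l <= r -> d <= f l) ->
  d * expR (- 2^-1) * (ln r - ln b) <= scale_moment f 0 b.
Proof.
move=> d0 b0 br fd; have r0 := lt_trans b0 br.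
set e := expR (- 2^-1); have e0 : 0 < e by exact: expR_gt0.
have FTC : (\int[mu]_(x in `[b, r]) (x^-1)%:E = (ln r)%:E - (ln b)%:E)%E.
  apply: continuous_FTC2 => //.
  - apply/continuous_in_subspaceT => x; rewrite inE/= in_itv/= => /andP[bx _].
    by apply: inv_continuous; rewrite gt_eqF// (lt_le_trans b0).
  - split.
    + move=> x; rewrite in_itv/= => /andP[bx _].
      exact: @ex_derive _ _ _ _ _ _ _ (is_derive1_ln (lt_trans b0 bx)).
    + by apply: cvg_at_right_filter; exact: continuous_ln.
    + by apply: cvg_at_left_filter; exact: continuous_ln.
  - move=> x; rewrite in_itv/= => /andP[bx _]; rewrite derive1E.
    by have /@derive_val := is_derive1_ln (lt_trans b0 bx).
have br_pos : `[b, r]%classic `<=` pos.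
  move=> x; rewrite posE /= in_itv/= => /andP[bx _].
  exact: lt_le_trans bx.
have iK := integrable_scale_kernel zero_in01 b0.
have mI : measurable (`[b, r]%classic : set (measurableTypeR R)).
  exact: measurable_itv.
rewrite -lee_fin /scale_moment fineK ?integrable_fin_num//.
apply: (@le_trans _ _
    (\int[mu]_(x in `[b, r]) (scale_kernel f 0 b x)%:E)%E); last first.
  apply: ge0_subset_integral => //; first exact: measurable_int iK.
  by move=> x; rewrite /= in_itv/= andbT => x0; rewrite lee_fin scale_kernel_ge0.
rewrite EFinM EFinB -FTC -ge0_integralZl//; last 3 first.
- apply/measurable_EFinP; apply: measurable_funS (@measurable_inv_pos R) => //.
- by move=> x /br_pos; rewrite posE => x0; rewrite lee_fin invr_ge0 ltW.
- by rewrite lee_fin mulr_ge0 ?ltW.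
apply: ge0_le_integral => //.
- move=> x /br_pos; rewrite posE => x0.
  by rewrite -EFinM lee_fin !mulr_ge0 ?invr_ge0 ?ltW.
- apply: emeasurable_funM => //; apply/measurable_EFinP.
  exact: measurable_funS (@measurable_inv_pos R).
- by apply: measurable_funS (measurable_int _ iK).
move=> x xbr; have := br_pos _ xbr; rewrite posE => x0.
move: xbr; rewrite /= in_itv/= => /andP[bx xr].
rewrite -EFinM lee_fin /scale_kernel oppr0 powRr0 mul1r.
rewrite -mulrA mulrC -[e * _]mulrC ler_pM ?fd ?mulr_ge0 ?invr_ge0 ?(ltW x0)
  ?(ltW e0) ?(ltW d0)//.
rewrite ler_wpM2l ?invr_ge0 ?(ltW x0)// ler_expR lerN2.
rewrite ler_pdivrMr ?mulr_gt0 ?exprn_gt0// mulrA mulVf// mul1r.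
by rewrite ler_pXn2r// nnegrE ltW.
Qed.

(** * The density near [lambda_min] and the bound on the posterior mean *)

(** Absolute continuity applied to a family of one interval. *)
Lemma abs_continuous_on_unif (A : set R) e : abs_continuous_on A f -> 0 < e ->
  exists2 d : R, 0 < d & forall x y, x <= y -> `[x, y] `<=` A -> y - x < d ->
    `|f y - f x| < e.
Proof.
move=> acf e0; have [d d0 hd] := acf _ e0; exists d => // x y xy xyA yxd.
have := hd 1%N (fun=> x) (fun=> y); rewrite !big_ord1; apply => //.
by move=> i j _ _ _; rewrite !ord1.
Qed.

Lemma lambda_min_ge0 : 0 <= lambda_min f.
Proof.
rewrite /lambda_min.
(* The infimum of the empty set is 0 by convention. *)
have [->|/set0P nS] := eqVneq [set l | 0 < l /\ 0 < f l] set0.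
  by rewrite inf0.
by apply: lb_le_inf => // x [/ltW].
Qed.

Lemma lt_lambda_min l : 0 < l -> l < lambda_min f -> f l = 0.
Proof.
move=> l0; apply: contraTeq => fl0; rewrite -leNgt; apply: ge_inf.
  by exists 0 => x [/ltW].
by split=> //; rewrite lt_neqAle eq_sym fl0 f_ge0.
Qed.

(* Either [f] vanishes at [0+], or uniform continuity keeps it away from [0]
   near [0], and then [scale_moment f 0 b] diverges logarithmically. *)
Lemma density_near0_le (eta K : R) :
  (pos_sup f < +oo)%E -> abs_continuous_at_min f -> lambda_min f = 0 ->
  0 < eta -> 0 < K ->
  exists2 b0 : R, 0 < b0 & forall b, 0 < b -> b <= b0 ->
    forall l, 0 < l -> l <= K * b -> f l <= eta * scale_moment f 0 b.
Proof.
move=> f_bdd [e e0 +] lm0; rewrite lm0 add0r => acf eta0 K0.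
have [M M0 fM] : exists2 M, 0 < M & forall l, 0 < l -> f l <= M.
  have fub l : 0 < l -> ((f l)%:E <= pos_sup f)%E.
    move=> l0; apply: ereal_sup_ubound; exists l => //.
    by rewrite /= in_itv/= l0.
  exists (`|fine (pos_sup f)| + 1) => [|l l0].
    by rewrite ltr_pwDr.
  have fin : pos_sup f \is a fin_num.
    by rewrite fin_numElt f_bdd andbT (lt_le_trans _ (fub 1 ltr01))// ltNyr.
  rewrite -lee_fin (le_trans (fub _ l0))// -[leLHS]fineK// lee_fin.
  by rewrite (le_trans (ler_norm _))// lerDl.
have [f0|] := pselect (forall d, 0 < d -> exists2 r, 0 < r &
    forall l, 0 < l -> l <= r -> f l <= d).
  have D1 : 0 < scale_moment f 0 1 by exact: scale_moment_gt0.
  have [r r0 fr] := f0 _ (mulr_gt0 eta0 D1).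
  (* [b <= 1] makes [scale_moment f 0 b] at least its value at 1, and [b <= r / K] keeps [l] below
     [r]. *)
  exists (Num.min 1 (r / K)) => [|b b0]; first by rewrite lt_min ltr01 divr_gt0.
  rewrite le_min => /andP[b1 brK] l l0 lKb.
  have lr : l <= r by rewrite (le_trans lKb)// mulrC -ler_pdivlMr.
  apply: (le_trans (fr l l0 lr)); rewrite (ler_pM2l eta0).
  exact: scale_moment0_le.
move=> /existsNP[d] /not_implyP[d0] /forall2NP nd.
have d2 : 0 < d / 2 by rewrite divr_gt0.
have [dd dd0 hdd] := abs_continuous_on_unif acf d2.
pose r := Num.min e dd / 2.
have med0 : 0 < Num.min e dd by rewrite lt_min e0.
have r0 : 0 < r by rewrite divr_gt0.
have r_lt : r < Num.min e dd by rewrite /r; lra.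
have /andP[re rd] : (r < e) && (r < dd) by rewrite -lt_min.
(* By [nd], some [x] in []0, r]] has [d < f x]. Any [l] in []0, r]] is within [dd] of it, so [f]
   drops by less than [d / 2] between them. *)
have fr l : 0 < l -> l <= r -> d / 2 <= f l.
  move=> l0 lr; have [//|/existsNP[x] /not_implyP[x0] /not_implyP[xr]] := nd r.
  move=> /negP; rewrite -ltNge => dx.
  have sub u v : 0 < u -> v <= r -> `[u, v] `<=` `[0, e[ `&` `]0, +oo[.
    move=> u0 vr z; rewrite /= !in_itv/= => /andP[uz zv].
    have z0 := lt_le_trans u0 uz.
    by rewrite z0 (ltW z0) (le_lt_trans zv (le_lt_trans vr re)).
  have [xl|/ltW lx] := leP x l.
    have : `|f l - f x| < d / 2 by apply: hdd => //; [exact: sub|lra].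
    by rewrite ltr_norml => /andP[]; lra.
  have : `|f x - f l| < d / 2 by apply: hdd => //; [exact: sub|lra].
  by rewrite ltr_norml => /andP[]; lra.
pose c := d / 2 * expR (- 2^-1).
have c0 : 0 < c by rewrite mulr_gt0 ?expR_gt0.
(* [b0] solves [eta * c * (ln r - ln b0) = M]: from there down, the logarithmic lower bound on the
   normalizing constant, times [eta], exceeds the global bound [M] on [f]. *)
pose b0 := r * expR (- (M / (eta * c))).
have Mec0 : 0 < M / (eta * c) by rewrite divr_gt0// mulr_gt0.
have b00 : 0 < b0 by rewrite mulr_gt0 ?expR_gt0.
exists b0 => // b b_gt0 bb0 l l_gt0 _.
have b0r : b0 < r by rewrite /b0 gtr_pMr// -expR0 ltr_expR oppr_lt0.
have := scale_moment0_ge_ln d2 b_gt0 (le_lt_trans bb0 b0r) fr.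
rewrite -/c -(ler_pM2l eta0); apply: le_trans.
rewrite (le_trans (fM _ l_gt0))// mulrA -ler_pdivrMl ?mulr_gt0// mulrC.
rewrite lerBrDr -lerBrDl -ler_ln ?posrE// in bb0 *.
by move: bb0; rewrite /b0 lnM ?posrE ?expR_gt0// expRK; lra.
Qed.

(** This is the input required by [exists_increasing_gauge]. *)
Lemma scale_moment_mean_le a e :
  (pos_sup f < +oo)%E -> abs_continuous_at_min f -> 0 <= a <= 1 -> 0 < e ->
  exists C, forall b, 0 < b ->
    scale_moment f a b / scale_moment f 0 b <= e * b `^ (- a) + C.
Proof.
move=> f_bdd f_ac a01 e0; have [a_ge0 a_le1] := andP a01.
have D0 b : 0 < b -> 0 < scale_moment f 0 b by exact: scale_moment_gt0.
have [a0|a_neq0] := eqVneq a 0.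
  exists 1 => b b0; rewrite a0 divff ?gt_eqF ?D0//.
  by rewrite lerDr mulr_ge0 ?powR_ge0// ltW.
have a_gt0 : 0 < a by rewrite lt_neqAle eq_sym a_neq0.
have [lm0|lm_neq0] := eqVneq (lambda_min f) 0; last first.
  have lm_gt0 : 0 < lambda_min f.
    by rewrite lt_neqAle eq_sym lm_neq0 lambda_min_ge0.
  (* [f] vanishes on []0, lambda_min f[], so the weight is at most its value at [lambda_min f]
     wherever the kernel is nonzero. *)
  exists (lambda_min f `^ (- a)) => b b0.
  rewrite ler_wpDl ?mulr_ge0 ?powR_ge0 ?(ltW e0)//.
  rewrite ler_pdivrMr ?D0//.
  have iK := integrable_scale_kernel zero_in01 b0.
  rewrite /scale_moment -(RintegralZl _ mpos iK).
  apply: le_Rintegral => //.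
  - exact: integrable_scale_kernel.
  - exact: integrableZ_EFin.
  move=> l; rewrite /= in_itv/= andbT => l0.
  have [ll|ll] := ltP l (lambda_min f).
    by rewrite /scale_kernel (lt_lambda_min l0 ll) !mulr0.
  have -> : scale_kernel f a b l = l `^ (- a) * scale_kernel f 0 b l.
    by rewrite /scale_kernel oppr0 powRr0 mul1r mulrA.
  rewrite ler_wpM2r ?scale_kernel_ge0// !powRN lef_pV2 ?posrE ?powR_gt0//.
  by rewrite ge0_ler_powR ?nnegrE// ltW.
(* [K] is chosen so that [K]^ (- a) = e / 2[. With the factor](2 * K ^+
   2)^-1[in the bound on]f[, both terms of]scale_moment_le[equal]e / 2 * b [^ (- a)] after division
   by the normalizing constant. *)
pose K := (e / 2) `^ (- a^-1).
have e2 : 0 < e / 2 by rewrite divr_gt0.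
have K0 : 0 < K by rewrite powR_gt0.
have Ka : K `^ (- a) = e / 2 by rewrite -powRrM mulrNN mulVf// powRr1// ltW.
have eta0 : 0 < (2 * K ^+ 2)^-1 by rewrite invr_gt0 mulr_gt0 ?exprn_gt0.
have [b0 b00 fb0] := density_near0_le f_bdd f_ac lm0 eta0 K0.
(* The constant is the posterior mean at [b0], which bounds the mean at every larger [b] by
   monotonicity. *)
exists (scale_moment f a b0 / scale_moment f 0 b0) => b b_gt0.
have [bb0|/ltW b0b] := leP b b0.
  apply: ler_wpDr.
    by apply/ltW/divr_gt0; [exact: scale_moment_gt0|exact: D0].
  rewrite ler_pdivrMr ?D0//.
  have s0 : 0 <= (2 * K ^+ 2)^-1 * scale_moment f 0 b.
    by rewrite mulr_ge0 ?ltW// D0.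
  have := scale_moment_le a01 b_gt0 K0 s0 (fb0 _ b_gt0 bb0).
  rewrite powRM ?(ltW K0) ?(ltW b_gt0)// Ka => /le_trans; apply.
  rewrite le_eqVlt; apply/orP; left; apply/eqP; field.
  by rewrite gt_eqF.
apply: ler_wpDl; first by rewrite mulr_ge0 ?powR_ge0 ?(ltW e0).
rewrite (ler_pdivrMr _ _ (D0 _ b_gt0)) mulrAC (ler_pdivlMr _ _ (D0 _ b00)).
exact: scale_moment_ratio_le.
Qed.

End moments.

(** * Expectation under the posterior law *)

Lemma local_scale_kernelE (R : realType) (f : R -> R) (tau beta l : R) :
  0 < tau -> 0 < l ->
  local_scale_kernel f tau beta l = scale_kernel f 0 (`|beta| / tau) l.
Proof.
move=> tau0 l0; rewrite /local_scale_kernel /scale_kernel oppr0 powRr0 mul1r.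
congr (_ * expR (- _) * _); rewrite expr_div_n real_normK ?num_real//.
by field; rewrite !gt_eqF.
Qed.

(** The kernel depends on [tau] and [beta] only through [b], and total mass 1 identifies [c] as the
    inverse of the normalizing constant. *)
Lemma expectation_local_scale (R : realType) (f : R -> R) (a tau beta : R)
    (P : probability (measurableTypeR R) R) :
  pos_density f -> 0 <= a <= 1 -> 0 < tau -> beta != 0 ->
  pos_density_proportional_to P (local_scale_kernel f tau beta) ->
  ('E_P[fun l : R => (tau `^ (- a) * l `^ (- a))%R] =
   (tau `^ (- a) * (scale_moment f a (`|beta| / tau) /
                    scale_moment f 0 (`|beta| / tau)))%:E)%E.
Proof.
move=> f_dens a01 tau0 beta0 [c c0 Pc].
set b := `|beta| / tau.
have b0 : 0 < b by rewrite divr_gt0 ?normr_gt0.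
have zero_in01 : 0 <= (0 : R) <= 1 by rewrite lexx ler01.
pose pos : set R := `]0, +oo[%classic.
have mpos : measurable (pos : set (measurableTypeR R)) by exact: measurable_itv.
have posE l : pos l = (0 < l) :> Prop by rewrite /pos/= in_itv/= andbT.
have iK a' : 0 <= a' <= 1 ->
    lebesgue_measure.-integrable pos (EFin \o scale_kernel f a' b).
  by move=> a'01; exact: integrable_scale_kernel.
have mE a' : 0 <= a' <= 1 ->
    (\int[lebesgue_measure]_(l in pos) (scale_kernel f a' b l)%:E =
     (scale_moment f a' b)%:E)%E.
  by move=> a'01; rewrite /scale_moment fineK// integrable_fin_num// iK.
have mK := measurable_int _ (iK 0 zero_in01).
have k0 a' l : pos l -> (0 <= (scale_kernel f a' b l)%:E)%E.
  by rewrite posE => l0; rewrite lee_fin scale_kernel_ge0.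
(* Extending the density by 0 off the positive half-line makes it a density on the whole line, as
   [ge0_integral_density] requires. *)
pose h : measurableTypeR R -> \bar R :=
  (fun l => c%:E * (scale_kernel f 0 b l)%:E)%E \_ pos.
have mh : measurable_fun setT h.
  by apply: (measurable_restrictT _ mpos).1; exact: emeasurable_funM mK.
have h0 l : (0 <= h l)%E.
  apply: erestrict_ge0 => {}l lpos.
  by rewrite mule_ge0 ?k0// lee_fin ltW.
have Ph A : measurable A -> P A = (\int[lebesgue_measure]_(l in A) h l)%E.
  move=> mA; rewrite Pc// integral_mkcondr; apply: eq_integral => l lA.
  rewrite /h !patchE; case: ifPn => // /set_mem; rewrite -/pos posE => l0.
  by rewrite -EFinM local_scale_kernelE.
have cD : c * scale_moment f 0 b = 1.
  have := Ph _ measurableT; rewrite probability_setT /h -integral_mkcond.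
  rewrite ge0_integralZl//; [|exact: k0|by rewrite lee_fin ltW].
  by rewrite mE// => -[].
rewrite expectation.unlock (@ge0_integral_density _ _ _ P lebesgue_measure h)//;
  last 2 first.
- by apply/measurable_EFinP; apply: measurable_funM.
- by move=> l; rewrite lee_fin mulr_ge0 ?powR_ge0.
transitivity (\int[lebesgue_measure]_(l in pos)
    ((tau `^ (- a) * c)%:E * (scale_kernel f a b l)%:E))%E.
  rewrite [RHS]integral_mkcond; apply: eq_integral => l _.
  rewrite /h !patchE; case: ifPn => _; last by rewrite mule0.
  by rewrite -!EFinM /scale_kernel oppr0 powRr0; congr EFin; ring.
rewrite ge0_integralZl//; [|exact: measurable_int (iK a a01)|exact: k0|]; last first.
  by rewrite lee_fin mulr_ge0 ?powR_ge0// ltW.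
rewrite mE// -EFinM; congr EFin; rewrite -mulrA; congr (_ * _).
by rewrite mulrC; congr (_ * _); apply/esym/mulr1_eq; rewrite mulrC.
Qed.

(** For [alpha = 0] the expectation is 1 and the bound reads [1 <= 2 * gamma (r0 / tau)], so [gamma]
    cannot vanish at 0; hence the guard [0 < alpha] on the limit. *)
Theorem proposition3p4 (R : realType) (r0 alpha : R) (piloc : R -> R)
  (r0_gt0 : 0 < r0) (alpha_ge0 : 0 <= alpha) (alpha_lt1 : alpha < 1)
  (piloc_density : pos_density piloc)
  (piloc_bounded : (pos_sup piloc < +oo)%E)
  (piloc_ac : abs_continuous_at_min piloc) :
  exists gamma : R -> R,
    [/\ (forall r, 0 < r -> 0 < gamma r),
        (forall r s, 0 < r -> r < s -> gamma r < gamma s),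
        (0 < alpha -> gamma r @[r --> 0^'+] --> 0) &
        forall (tau beta : R) (P : probability (measurableTypeR R) R),
          0 < tau -> beta != 0 ->
          pos_density_proportional_to P (local_scale_kernel piloc tau beta) ->
          ('E_P[fun l : R => (tau `^ (- alpha) * l `^ (- alpha))%R] <=
           (gamma (r0 / tau) * (`|beta| `^ (- alpha) + `|r0| `^ (- alpha)))%:E)%E].
Proof.
have a01 : 0 <= alpha <= 1 by rewrite alpha_ge0 ltW.
pose F b := scale_moment piloc alpha b / scale_moment piloc 0 b.
have F0 b : 0 < b -> 0 <= F b.
  move=> b0; apply/ltW/divr_gt0; apply: scale_moment_gt0 => //.
  by rewrite lexx ler01.
have Fle e : 0 < e ->
    exists C, forall b, 0 < b -> F b <= e * b `^ (- alpha) + C.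
  by move=> e0; exact: scale_moment_mean_le.
have [gamma [gamma_gt0 gamma_inc gamma_cvg Fgamma]] :=
  exists_increasing_gauge alpha_ge0 F0 Fle.
exists gamma; split => // tau beta P tau0 beta0 hP.
rewrite (expectation_local_scale piloc_density a01 tau0 beta0 hP) lee_fin.
have nb0 : 0 < `|beta| by rewrite normr_gt0.
have := Fgamma _ _ (divr_gt0 nb0 tau0) (divr_gt0 r0_gt0 tau0).
rewrite -(ler_pM2l (powR_gt0 (- alpha) tau0)) => /le_trans; apply.
have tauM x : 0 < x ->
    tau `^ (- alpha) * (x / tau) `^ (- alpha) = x `^ (- alpha).
  by move=> x0; rewrite -powRM ?divr_ge0 ?ltW// mulrC divfK ?gt_eqF.
by rewrite mulrCA mulrDr !tauM// (gtr0_norm r0_gt0).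
Qed.
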